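(* Let $0<\kappa<\infty$, let $C_\kappa$ be the tropical Hesse curve and $\bar C_\kappa$ its bounded part, with vertices $V_1=(\kappa,\kappa)$, $V_2=(-\kappa,0)$, $V_3=(0,-\kappa)$, equipped with its additive group structure with unit $V_1$. Let $E_i$ be the edge of $C_\kappa$ connecting the vertex $V_i$ with $V_{i+1}$ for $i=1,2,3$, where $V_4=V_1$, the subscripts of $E$ being reduced modulo $3$. Let $P=(X,Y)$ be a point on an edge $E_j$ for a fixed $j\in\{1,2,3\}$, let $Q=(X',Y')\in\bar C_\kappa$, and write $P+Q=(X'',Y'')$ for the sum of $P$ and $Q$ in the group $\bar C_\kappa$. Then $P+Q$ is given by the following addition formulae: (1) $$X''=\max(Y,\,2X+X'+Y')-\max(X+2X',\,2Y+Y'),$$ $$Y''=\max(X+Y+2Y',\,X')-\max(X+2X',\,2Y+Y'),$$ if and only if $Q\in E_j\cup E_{j+1}$; (2) $$X''=\max(X+Y+2X',\,Y')-\max(Y+2Y',\,2X+X'),$$ $$Y''=\max(X,\,2Y+X'+Y')-\max(Y+2Y',\,2X+X'),$$ if and only if $Q\in E_j\cup E_{j+2}$; or (3) $$X''=\max(X+2Y',\,2Y+X')-\max(X+Y,\,X'+Y'),$$ $$Y''=\max(Y+2X',\,2X+Y')-\max(X+Y,\,X'+Y'),$$ if and only if $Q\in E_{j+1}\cup E_{j+2}$.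
   Context: Tropical Hesse curve. $C_\kappa$ is the tropical curve consisting of the points $(X,Y)$ at which $F(X,Y;\kappa)=\max(3X,3Y,0,\kappa+X+Y)$ is not differentiable. For $0<\kappa<\infty$, $\bar C_\kappa$ denotes $C_\kappa$ with its unbounded edges removed: it is the boundary of the triangle with vertices $V_1=(\kappa,\kappa)$, $V_2=(-\kappa,0)$, $V_3=(0,-\kappa)$. Its edges $V_1V_2$, $V_2V_3$, $V_3V_1$ have primitive integer direction vectors $\pm(2,1)$, $\pm(1,-1)$, $\pm(1,2)$, respectively. Length along an edge is lattice length (a primitive integer direction vector has length $1$), so each edge has length $\kappa$ and $\bar C_\kappa$ is a metric circle of total length $3\kappa$. Group structure. The tropical Jacobian is $J(C_\kappa)=\mathbb{R}/3\kappa\mathbb{Z}$. The additive group structure on $\bar C_\kappa$ with unit $V_1$ is transported from $J(C_\kappa)$ by the bijection $\tilde\varphi:J(C_\kappa)\to\bar C_\kappa$ that parametrizes $\bar C_\kappa$ by lattice length with $\tilde\varphi(0)=V_1$, $\tilde\varphi(\kappa)=V_2$, $\tilde\varphi(2\kappa)=V_3$. Explicitly, for $0\le t\le\kappa$: $\tilde\varphi(t)=(\kappa-2t,\kappa-t)$, $\tilde\varphi(\kappa+t)=(-\kappa+t,-t)$, $\tilde\varphi(2\kappa+t)=(t,-\kappa+2t)$. (Equivalently, the group structure is the one transported from $\mathrm{Pic}^0(\bar C_\kappa)$, degree-$0$ divisors modulo principal divisors of piecewise linear functions with integer slopes, by $P\mapsto[P-V_1]$.)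
   Formalization: The ''only if'' parts are asserted only for P not a vertex V_1, V_2, V_3: at a vertex all three formulae give P+Q for every Q, e.g. κ=1, P=V_1, j=1, Q=(1/2,0) satisfies (1) though Q is not in E_1∪E_2. The ''if'' parts hold for all P in E_j. *)

(* Defs.v *)
From HB Require Import structures.
From mathcomp Require Import all_boot all_order all_algebra generic_quotient ring_quotient.
From mathcomp Require Import all_classical all_reals all_analysis.
From mathcomp Require Import ring lra zify.

Set Implicit Arguments.
Unset Strict Implicit.
Unset Printing Implicit Defensive.

Import Order.TTheory GRing.Theory Num.Theory.
Import numFieldNormedType.Exports.

Local Open Scope classical_set_scope.
Local Open Scope ring_scope.
Local Open Scope quotient_scope.

Section Curve.
Variables (R : realType) (k : R).

Definition hesse_poly (p : R * R) : R :=
  Num.max (Num.max (Num.max (3 * p.1) (3 * p.2)) 0) (k + p.1 + p.2).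

Definition hesse_curve : set (R * R) := [set p | ~ differentiable hesse_poly p].

(* Subscripts live in 'Z_3, so that 3 = 0 (the last branch) and V_4 = V_1;
   likewise for the edges. *)
Definition vertex (i : 'Z_3) : R * R :=
  if i == 1 then (k, k) else if i == 2 then (- k, 0) else (0, - k).

Definition edge (i : 'Z_3) : set (R * R) :=
  [set (1 - t) *: vertex i + t *: vertex (i + 1) | t in `[0, 1]].

Definition ray_dir (i : 'Z_3) : R * R :=
  if i == 1 then (1, 1) else if i == 2 then (-1, 0) else (0, -1).

(* The unbounded edge at V_i, without its end point V_i; hesse_curveE below shows
   that the edges and the rays together make up the curve. *)
Definition ray (i : 'Z_3) : set (R * R) :=
  [set vertex i + t *: ray_dir i | t in [set t : R | 0 < t]].

Definition hesse_bar : set (R * R) := hesse_curve `\` \bigcup_i ray i.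

(* The subgroup 3kZ of R. *)
Definition periods : {pred R} :=
  [pred x | `[< exists n : int, x = n%:~R * (3 * k) >]].

Fact periods_zmod_closed : zmod_closed periods.
Proof.
split=> [|x y /asboolP [m ->] /asboolP [n ->]]; apply/asboolP.
  by exists 0; rewrite mul0r.
by exists (m - n); rewrite intrB mulrBl.
Qed.

HB.instance Definition _ := GRing.isZmodClosed.Build R periods
  periods_zmod_closed.

(* R / 3kZ. *)
Definition trop_jacobian : zmodType := Quotient.quot periods.

(* The lattice-length parametrization from V_1 towards V_2, for t in [0, 3k]. *)
Definition phi_rep (t : R) : R * R :=
  if t <= k then (k - 2 * t, k - t)
  else if t <= 2 * k then (- k + (t - k), - (t - k))
  else (t - 2 * k, - k + 2 * (t - 2 * k)).

(* The representative of t modulo 3k in [0, 3k[, when 0 < k. *)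
Definition reduce (t : R) : R := t - (Num.floor (t / (3 * k)))%:~R * (3 * k).

Definition phi (u : trop_jacobian) : R * R := phi_rep (reduce (repr u)).

(* phi is a bijection onto hesse_bar k when 0 < k (phi_bij), which makes phi_inv
   its inverse there and hesse_add the transported group law (hesse_addE); both
   are junk outside hesse_bar k. *)
Definition phi_inv (p : R * R) : trop_jacobian := xget 0 [set u | phi u = p].

Definition hesse_add (p q : R * R) : R * R := phi (phi_inv p + phi_inv q).

End Curve.

Section Facts.
Variable (R : realType).

Definition aff (a b c : R) (p : R * R) : R := a * p.1 + b * p.2 + c.

Lemma aff_cts a b c : continuous (aff a b c).
Proof.
move=> x; apply: cvgD; last exact: cvg_cst.
apply: cvgD; apply: cvgM; (exact: cvg_cst || exact: cvg_fst || exact: cvg_snd).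
Qed.

Lemma near_eq_differentiable (f g : R * R -> R) x :
  {near x, f =1 g} -> differentiable f x -> differentiable g x.
Proof.
move=> fg df.
have fgx : f x = g x by apply: nbhs_singleton fg.
have [cf ef] := (diff_locallyP x f).1 df.
have eg : g \o shift x = cst (g x) + 'd f x +o_ 0 id.
  apply/eqaddoP => e e0.
  have fg0 : \forall h \near (0 : R * R), f (h + x) = g (h + x).
    by have := fg; rewrite (near_shift (0 : R * R)) subr0.
  have fo := (eqaddoP _ _ _ _).1 ef e e0.
  apply: filterS2 fg0 fo => h fgh.
  by rewrite /= -[(f \o _ - _) h]/(f (h + x) - (f x + 'd f x h))
    -[(g \o _ - _) h]/(g (h + x) - (g x + 'd f x h)) fgx fgh.
have dfg := diff_unique cf eg.
by apply/diff_locallyP; rewrite dfg; split.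
Qed.

Lemma aff_differentiable a b c x : differentiable (aff a b c) x.
Proof.
have -> : aff a b c = a *: (fst : R * R -> R) + b *: (snd : R * R -> R) + cst c.
  by apply/funext.
have d1 : differentiable (fst : R * R -> R) x.
  by apply: linear_differentiable => y; exact: cvg_fst.
have d2 : differentiable (snd : R * R -> R) x.
  by apply: linear_differentiable => y; exact: cvg_snd.
exact: (differentiableD (differentiableD (differentiableZ a d1)
  (differentiableZ b d2)) (differentiable_cst c x)).
Qed.

Lemma derive_ge_aff (f : R * R -> R) a b c x v :
  differentiable f x -> (forall q, aff a b c q <= f q) -> aff a b c x = f x ->
  'D_v f x = a * v.1 + b * v.2.
Proof.
move=> df le e; set s := RHS.
have dq : derivable f x v by exact: diff_derivable.
have /cvgrPdist_lt cvgq : h^-1 *: ((f \o shift x) (h *: v) - f x) @[h --> 0^'] --> 'D_v f x := dq.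
have key h : h * s <= f (h *: v + x) - f x.
  by have := le (h *: v + x); rewrite -e /aff /s /= /GRing.scale /=; lra.
apply/eqP; rewrite -subr_eq0; apply: contraT => n0.
have e0 : 0 < `|'D_v f x - s| by rewrite normr_gt0.
have [d /= d0 H] := cvgq _ e0.
have Hp : `|'D_v f x - (d/2)^-1 * (f ((d/2) *: v + x) - f x)| < `|'D_v f x - s|.
  apply: (H (d/2)); last by rewrite gt_eqF // divr_gt0.
  by rewrite /= sub0r normrN ger0_norm; lra.
have Hm : `|'D_v f x - (-(d/2))^-1 * (f ((-(d/2)) *: v + x) - f x)| < `|'D_v f x - s|.
  apply: (H (-(d/2))); last by rewrite lt_eqF // oppr_lt0 divr_gt0.
  by rewrite /= sub0r opprK ger0_norm; lra.
have kp : s <= (d/2)^-1 * (f ((d/2) *: v + x) - f x).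
  by rewrite mulrC ler_pdivlMr; [rewrite mulrC; exact: key|lra].
have km : (-(d/2))^-1 * (f ((-(d/2)) *: v + x) - f x) <= s.
  rewrite mulrC ler_ndivrMr; last lra.
  by rewrite mulrC; exact: key.
move: Hp Hm; rewrite -/s.
set A := (d / 2)^-1 * _ in kp *; set B := (- (d / 2))^-1 * _ in km *.
set D := 'D_v f x.
have [DS|DS] := leP D s.
  rewrite (ler0_norm (x := D - s)) ?subr_le0 // => + _.
  by rewrite ltr_norml; lra.
rewrite (gtr0_norm (x := D - s)) ?subr_gt0 // => _.
by rewrite ltr_norml; lra.
Qed.

Lemma near_aff_lt a b c a' b' c' (p : R * R) : aff a b c p < aff a' b' c' p ->
  \forall q \near p, aff a b c q < aff a' b' c' q.
Proof.
move=> lt; have c1 := @aff_cts (a' - a) (b' - b) (c' - c) p.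
have lt' : 0 < aff (a' - a) (b' - b) (c' - c) p by move: lt; rewrite /aff; lra.
have H := @cvgr_gt _ _ _ (nbhs_filter p) _ _ c1 _ lt'.
move: H; apply: filterS => q; rewrite /aff; lra.
Qed.

Variables (k : R) (k0 : 0 < k).

Lemma Z3_ind (P : 'Z_3 -> Prop) : P 1 -> P 2 -> P 3 -> forall i, P i.
Proof.
move=> P1 P2 P3 [[|[|[|i]]] hi] //.
- by have <- : 3 = Ordinal hi :> 'Z_3 by exact/val_inj.
- by have <- : 1 = Ordinal hi :> 'Z_3 by exact/val_inj.
- by have <- : 2 = Ordinal hi :> 'Z_3 by exact/val_inj.
Qed.

Lemma edgeE (i : 'Z_3) (p : R * R) : edge k i p <-> exists t : R,
  [/\ 0 <= t, t <= 1,
    p.1 = (1 - t) * (vertex k i).1 + t * (vertex k (i + 1)).1 &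
    p.2 = (1 - t) * (vertex k i).2 + t * (vertex k (i + 1)).2].
Proof.
split=> [[t] /=|[t [t0 t1 e1 e2]]].
  by rewrite in_itv /= => /andP[? ?] <-; exists t; split.
exists t; first by rewrite /= in_itv /= t0.
by rewrite [RHS]surjective_pairing e1 e2.
Qed.

Lemma Z3D : (((1 + 1)%R = 2%R :> 'Z_3) * ((2 + 1)%R = 3%R :> 'Z_3) *
  ((3 + 1)%R = 1%R :> 'Z_3))%type.
Proof. by split; [split|]; exact/val_inj. Qed.

Lemma vertexE : ((vertex k 1 = (k, k)) * (vertex k 2 = ((- k)%R, 0%R)) *
  (vertex k 3 = (0%R, (- k)%R)))%type.
Proof. by []. Qed.

Lemma edge1E (p : R * R) :
  edge k 1 p <-> [/\ 2 * p.2 = k + p.1, 0 <= p.2 & p.2 <= k].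
Proof.
rewrite edgeE Z3D !vertexE /=; split=> [[t [t0 t1 -> ->]]|[e l1 l2]].
  have tk := mulr_ge0 t0 (ltW k0).
  have tk' : t * k <= k by rewrite -[leRHS]mul1r ler_pM2r.
  by split; lra.
have tk : (k - p.2) / k * k = k - p.2 by rewrite divfK ?gt_eqF.
exists ((k - p.2) / k); split; try lra.
  by rewrite divr_ge0 //; lra.
by rewrite ler_pdivrMr //; lra.
Qed.

Lemma edge2E (p : R * R) :
  edge k 2 p <-> [/\ p.1 + p.2 = - k, - k <= p.1 & p.1 <= 0].
Proof.
rewrite edgeE Z3D !vertexE /=; split=> [[t [t0 t1 -> ->]]|[e l1 l2]].
  have tk := mulr_ge0 t0 (ltW k0).
  have tk' : t * k <= k by rewrite -[leRHS]mul1r ler_pM2r.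
  by split; lra.
have tk : (k + p.1) / k * k = k + p.1 by rewrite divfK ?gt_eqF.
exists ((k + p.1) / k); split; try lra.
  by rewrite divr_ge0 //; lra.
by rewrite ler_pdivrMr //; lra.
Qed.

Lemma edge3E (p : R * R) :
  edge k 3 p <-> [/\ p.2 = 2 * p.1 - k, 0 <= p.1 & p.1 <= k].
Proof.
rewrite edgeE Z3D !vertexE /=; split=> [[t [t0 t1 -> ->]]|[e l1 l2]].
  have tk := mulr_ge0 t0 (ltW k0).
  have tk' : t * k <= k by rewrite -[leRHS]mul1r ler_pM2r.
  by split; lra.
have tk : (p.1) / k * k = p.1 by rewrite divfK ?gt_eqF.
exists ((p.1) / k); split; try lra.
  by rewrite divr_ge0 //; lra.
by rewrite ler_pdivrMr //; lra.
Qed.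

Lemma rayE (i : 'Z_3) (p : R * R) : ray k i p <-> exists t : R,
  [/\ 0 < t, p.1 = (vertex k i).1 + t * (ray_dir R i).1 &
    p.2 = (vertex k i).2 + t * (ray_dir R i).2].
Proof.
split=> [[t /= t0 <-]|[t [t0 e1 e2]]]; first by exists t.
by exists t => //; rewrite [RHS]surjective_pairing e1 e2.
Qed.

Lemma raydirE : ((ray_dir R 1 = (1%R, 1%R)) * (ray_dir R 2 = ((-1)%R, 0%R)) *
  (ray_dir R 3 = (0%R, (-1)%R)))%type.
Proof. by []. Qed.

Lemma ray1E (p : R * R) : ray k 1 p <-> p.1 = p.2 /\ k < p.1.
Proof.
rewrite rayE raydirE vertexE /=; split=> [[t [t0 -> ->]]|[e l]]; first by split; lra.
by exists (p.1 - k); split; lra.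
Qed.

Lemma ray2E (p : R * R) : ray k 2 p <-> p.2 = 0 /\ p.1 < - k.
Proof.
rewrite rayE raydirE vertexE /=; split=> [[t [t0 -> ->]]|[e l]]; first by split; lra.
by exists (- k - p.1); split; lra.
Qed.

Lemma ray3E (p : R * R) : ray k 3 p <-> p.1 = 0 /\ p.2 < - k.
Proof.
rewrite rayE raydirE vertexE /=; split=> [[t [t0 -> ->]]|[e l]]; first by split; lra.
by exists (- k - p.2); split; lra.
Qed.

Lemma hesse_polyE p : [/\ aff 3 0 0 p <= hesse_poly k p,
  aff 0 3 0 p <= hesse_poly k p, aff 0 0 0 p <= hesse_poly k p,
  aff 1 1 k p <= hesse_poly k p & [\/ hesse_poly k p = aff 3 0 0 p,
  hesse_poly k p = aff 0 3 0 p, hesse_poly k p = aff 0 0 0 p |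
  hesse_poly k p = aff 1 1 k p]].
Proof.
have -> : aff 3 0 0 p = 3 * p.1 by rewrite /aff; ring.
have -> : aff 0 3 0 p = 3 * p.2 by rewrite /aff; ring.
have -> : aff 0 0 0 p = 0 by rewrite /aff; ring.
have -> : aff 1 1 k p = k + p.1 + p.2 by rewrite /aff; ring.
rewrite /hesse_poly !le_max !lexx ?orbT; split=> //.
case: (leP (Num.max (Num.max (3 * p.1) (3 * p.2)) 0)); first by move=> *; apply: Or44.
case: (leP (Num.max (3 * p.1) (3 * p.2))); first by move=> *; apply: Or43.
by case: (leP (3 * p.1)) => *; [apply: Or42|apply: Or41].
Qed.

Lemma tie_cases (X Y : R) :
  (2 * Y = k + X -> Y < 0 \/ k < Y) ->
  (X + Y = - k -> X < - k \/ 0 < X) ->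
  (Y = 2 * X - k -> X < 0 \/ k < X) ->
  (X = Y -> X <= k) -> (Y = 0 -> - k <= X) -> (X = 0 -> - k <= Y) ->
  ~ [/\ 3 * Y < 3 * X, 0 < 3 * X & k + X + Y < 3 * X] ->
  ~ [/\ 3 * X < 3 * Y, 0 < 3 * Y & k + X + Y < 3 * Y] ->
  ~ [/\ 3 * X < 0, 3 * Y < 0 & k + X + Y < 0] ->
  ~ [/\ 3 * X < k + X + Y, 3 * Y < k + X + Y & 0 < k + X + Y] -> False.
Proof.
move=> e1 e2 e3 r1 r2 r3 u1 u2 u3 u4.
  have [xy|xy|xy] := ltgtP X Y.
  - have [y0|y0|y0] := ltgtP Y 0.
    + have [d|d|d] := ltgtP 0 (k + X + Y).
      * by apply: u4; split; lra.
      * by apply: u3; split; lra.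
      * by case: e2 => *; lra.
    + have [d|d|d] := ltgtP (3 * Y) (k + X + Y).
      * by apply: u4; split; lra.
      * by apply: u2; split; lra.
      * by case: e1 => *; lra.
    + have := r2 y0; move=> ?.
      have [d|d] := eqVneq X (- k); first by case: e1 => *; lra.
      by move: d; rewrite neq_lt => /orP[] ?; first lra; apply: u4; split; lra.
  - have [x0|x0|x0] := ltgtP X 0.
    + have [d|d|d] := ltgtP 0 (k + X + Y).
      * by apply: u4; split; lra.
      * by apply: u3; split; lra.
      * by case: e2 => *; lra.
    + have [d|d|d] := ltgtP (3 * X) (k + X + Y).
      * by apply: u4; split; lra.
      * by apply: u1; split; lra.
      * by case: e3 => *; lra.
    + have := r3 x0; move=> ?.
      have [d|d] := eqVneq Y (- k); first by case: e3 => *; lra.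
      by move: d; rewrite neq_lt => /orP[] ?; first lra; apply: u4; split; lra.
  - have := r1 xy; move=> ?.
    have [d|d|d] := ltgtP X k; [|lra|by case: e1; move: k0 d xy; clear; lra].
    have [d'|d'|d'] := ltgtP 0 (k + X + Y).
    + by apply: u4; split; lra.
    + by apply: u3; split; lra.
    + by case: e2 => *; lra.
Qed.

Lemma hesse_curveE :
  hesse_curve k = \bigcup_i edge k i `|` \bigcup_i ray k i.
Proof.
apply/seteqP; split=> [p nd|p].
  have [a1 a2 a3 a4 _] := hesse_polyE p.
  have dn a b c : (\forall q \near p, hesse_poly k q = aff a b c q) -> False.
    move=> H; apply: nd; apply: near_eq_differentiable (aff_differentiable a b c p).
    by apply: filterS H => q ->.
  have un a b c (H1 : \forall q \near p, aff 3 0 0 q <= aff a b c q)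
    (H2 : \forall q \near p, aff 0 3 0 q <= aff a b c q)
    (H3 : \forall q \near p, aff 0 0 0 q <= aff a b c q)
    (H4 : \forall q \near p, aff 1 1 k q <= aff a b c q) 
    (H5 : forall q, aff a b c q <= hesse_poly k q) : False.
    apply: (dn a b c); near=> q.
    have h1 : aff 3 0 0 q <= aff a b c q by near: q.
    have h2 : aff 0 3 0 q <= aff a b c q by near: q.
    have h3 : aff 0 0 0 q <= aff a b c q by near: q.
    have h4 : aff 1 1 k q <= aff a b c q by near: q.
    apply/le_anti; rewrite H5 andbT.
    by have [_ _ _ _ [] ->] := hesse_polyE q.
  have nle a b c a' b' c' : aff a b c p < aff a' b' c' p ->
      \forall q \near p, aff a b c q <= aff a' b' c' q.
    by move=> /near_aff_lt; apply: filterS => q /ltW.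
  have nre a b c : \forall q \near p, aff a b c q <= aff a b c q.
    by near=> q.
  have u1 : ~ [/\ aff 0 3 0 p < aff 3 0 0 p, aff 0 0 0 p < aff 3 0 0 p &
      aff 1 1 k p < aff 3 0 0 p].
    case=> *; apply: (un 3 0 0); try exact: nre; try exact: nle; move=> q.
    by have [] := hesse_polyE q.
  have u2 : ~ [/\ aff 3 0 0 p < aff 0 3 0 p, aff 0 0 0 p < aff 0 3 0 p &
      aff 1 1 k p < aff 0 3 0 p].
    case=> *; apply: (un 0 3 0); try exact: nre; try exact: nle; move=> q.
    by have [] := hesse_polyE q.
  have u3 : ~ [/\ aff 3 0 0 p < aff 0 0 0 p, aff 0 3 0 p < aff 0 0 0 p &
      aff 1 1 k p < aff 0 0 0 p].
    case=> *; apply: (un 0 0 0); try exact: nre; try exact: nle; move=> q.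
    by have [] := hesse_polyE q.
  have u4 : ~ [/\ aff 3 0 0 p < aff 1 1 k p, aff 0 3 0 p < aff 1 1 k p &
      aff 0 0 0 p < aff 1 1 k p].
    case=> *; apply: (un 1 1 k); try exact: nre; try exact: nle; move=> q.
    by have [] := hesse_polyE q.
  apply: contrapT => nin; move: u1 u2 u3 u4.
  have e1 : ~ edge k 1 p by move=> ?; apply: nin; left; exists 1.
  have e2 : ~ edge k 2 p by move=> ?; apply: nin; left; exists 2.
  have e3 : ~ edge k 3 p by move=> ?; apply: nin; left; exists 3.
  have r1 : ~ ray k 1 p by move=> ?; apply: nin; right; exists 1.
  have r2 : ~ ray k 2 p by move=> ?; apply: nin; right; exists 2.
  have r3 : ~ ray k 3 p by move=> ?; apply: nin; right; exists 3.
  have [f1 f2 f3 f4] : [/\ aff 3 0 0 p = 3 * p.1, aff 0 3 0 p = 3 * p.2,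
      aff 0 0 0 p = 0 & aff 1 1 k p = k + p.1 + p.2].
    by split; rewrite /aff; ring.
  rewrite f1 f2 f3 f4.
  move: e1 e2 e3 r1 r2 r3; rewrite edge1E edge2E edge3E ray1E ray2E ray3E.
  clear -k0; case: p => X Y /=.
  move=> e1 e2 e3 r1 r2 r3 u1 u2 u3 u4.
  have {}e1 : 2 * Y = k + X -> Y < 0 \/ k < Y.
    by move=> e; case: (ltP Y 0); [left|right]; case: (ltP k Y) => // ?; exfalso; apply: e1.
  have {}e2 : X + Y = - k -> X < - k \/ 0 < X.
    by move=> e; case: (ltP X (-k)); [left|right]; case: (ltP 0 X) => // ?; exfalso; apply: e2.
  have {}e3 : Y = 2 * X - k -> X < 0 \/ k < X.
    by move=> e; case: (ltP X 0); [left|right]; case: (ltP k X) => // ?; exfalso; apply: e3.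
  have {}r1 : X = Y -> X <= k by move=> e; case: (leP X k) => // ?; exfalso; apply: r1.
  have {}r2 : Y = 0 -> - k <= X by move=> e; case: (leP (-k) X) => // ?; exfalso; apply: r2.
  have {}r3 : X = 0 -> - k <= Y by move=> e; case: (leP (-k) Y) => // ?; exfalso; apply: r3.
  exact: (@tie_cases X Y).
have conf a b c a' b' c' (v : R * R) :
    (forall q, aff a b c q <= hesse_poly k q) ->
    (forall q, aff a' b' c' q <= hesse_poly k q) ->
    aff a b c p = hesse_poly k p -> aff a' b' c' p = hesse_poly k p ->
    a * v.1 + b * v.2 != a' * v.1 + b' * v.2 -> ~ differentiable (hesse_poly k) p.
  move=> l l' e e' /eqP ne df; apply: ne.
  by rewrite -(derive_ge_aff v df l e) -(derive_ge_aff v df l' e').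
have [g1 g2 g3 g4] : [/\ forall q, aff 3 0 0 q <= hesse_poly k q,
    forall q, aff 0 3 0 q <= hesse_poly k q,
    forall q, aff 0 0 0 q <= hesse_poly k q &
    forall q, aff 1 1 k q <= hesse_poly k q].
  by split=> q; have [] := hesse_polyE q.
have [_ _ _ _ hM] := hesse_polyE p.
have eqM x : x <= hesse_poly k p -> aff 3 0 0 p <= x -> aff 0 3 0 p <= x ->
    aff 0 0 0 p <= x -> aff 1 1 k p <= x -> x = hesse_poly k p.
  by move=> *; apply/le_anti/andP; split=> //; case: hM => ->.
have ne : (3 != 0 :> R) /\ (3 != 1 :> R) by split; apply/eqP; lra.
case=> -[i _]; move: i; elim/Z3_ind; rewrite ?edge1E ?edge2E ?edge3E ?ray1E ?ray2E ?ray3E.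
- case=> h1 h2 h3; apply: (conf _ _ _ _ _ _ (0, 1) g2 g4).
  + by apply: eqM => //; rewrite /aff; move: k0 h1 h2 h3; clear; lra.
  + by apply: eqM => //; rewrite /aff; move: k0 h1 h2 h3; clear; lra.
  + by apply/eqP => /= H; move: H k0; clear; lra.
- case=> h1 h2 h3; apply: (conf _ _ _ _ _ _ (0, 1) g3 g4).
  + by apply: eqM => //; rewrite /aff; move: k0 h1 h2 h3; clear; lra.
  + by apply: eqM => //; rewrite /aff; move: k0 h1 h2 h3; clear; lra.
  + by apply/eqP => /= H; move: H k0; clear; lra.
- case=> h1 h2 h3; apply: (conf _ _ _ _ _ _ (1, 0) g1 g4).
  + by apply: eqM => //; rewrite /aff; move: k0 h1 h2 h3; clear; lra.
  + by apply: eqM => //; rewrite /aff; move: k0 h1 h2 h3; clear; lra.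
  + by apply/eqP => /= H; move: H k0; clear; lra.
- case=> h1 h2; apply: (conf _ _ _ _ _ _ (0, 1) g1 g2).
  + by apply: eqM => //; rewrite /aff; move: k0 h1 h2; clear; lra.
  + by apply: eqM => //; rewrite /aff; move: k0 h1 h2; clear; lra.
  + by apply/eqP => /= H; move: H k0; clear; lra.
- case=> h1 h2; apply: (conf _ _ _ _ _ _ (0, 1) g2 g3).
  + by apply: eqM => //; rewrite /aff; move: k0 h1 h2; clear; lra.
  + by apply: eqM => //; rewrite /aff; move: k0 h1 h2; clear; lra.
  + by apply/eqP => /= H; move: H k0; clear; lra.
- case=> h1 h2; apply: (conf _ _ _ _ _ _ (1, 0) g1 g3).
  + by apply: eqM => //; rewrite /aff; move: k0 h1 h2; clear; lra.
  + by apply: eqM => //; rewrite /aff; move: k0 h1 h2; clear; lra.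
  + by apply/eqP => /= H; move: H k0; clear; lra.
Unshelve. all: by end_near.
Qed.

Lemma hesse_barE : hesse_bar k = \bigcup_i edge k i.
Proof.
rewrite /hesse_bar hesse_curveE; apply/seteqP; split=> [p [[]]//|p ep].
split; first by left.
case: ep => i _ + [j _]; move: i j; elim/Z3_ind; elim/Z3_ind;
  rewrite ?edge1E ?edge2E ?edge3E ?ray1E ?ray2E ?ray3E => -[? ? ?] [? ?]; lra.
Qed.


Let k3 : 0 < 3 * k. Proof. by rewrite mulr_gt0. Qed.

Lemma periodsP (x : R) :
  reflect (exists n : int, x = n%:~R * (3 * k)) (x \in periods k).
Proof. exact: asboolP. Qed.

Lemma reduce_itv (t : R) : 0 <= reduce k t < 3 * k.
Proof.
have /andP[fl fu] := floor_itv (t / (3 * k)).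
move: fl fu; rewrite /reduce ler_pdivlMr // ltr_pdivrMr // intrD.
by move=> fl fu; apply/andP; split; lra.
Qed.

Lemma reduce_periods (t : R) : t - reduce k t \in periods k.
Proof. by apply/periodsP; exists (Num.floor (t / (3 * k))); rewrite /reduce subKr. Qed.

Lemma periods_small x : x \in periods k -> - (3 * k) < x < 3 * k -> x = 0.
Proof.
move=> /periodsP[n ->] /andP[l1 l2].
have n1 : -1 < n by rewrite -(ltr_int R) intrN -(ltr_pM2r k3); lra.
have n2 : n < 1 by rewrite -(ltr_int R) -(ltr_pM2r k3); lra.
have -> : n = 0 by lia.
by rewrite mul0r.
Qed.

Lemma jacobian_eq (s t : R) :
  (\pi_(trop_jacobian k) s = \pi_(trop_jacobian k) t) <-> s - t \in periods k.
Proof. 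
rewrite Quotient.idealrBE; split=> [/eqP|/eqP] //.
Qed.

Lemma reduce_eq (s t : R) : s - t \in periods k -> reduce k s = reduce k t.
Proof.
move=> st; apply/eqP; rewrite -subr_eq0; apply/eqP/periods_small.
  have -> : reduce k s - reduce k t = (t - reduce k t) - (s - reduce k s) + (s - t) by ring.
  by rewrite rpredD // rpredB // reduce_periods.
have /andP[? ?] := reduce_itv s; have /andP[? ?] := reduce_itv t.
by apply/andP; split; lra.
Qed.

Lemma reduce_id (t : R) : 0 <= t < 3 * k -> reduce k t = t.
Proof.
move=> /andP[t0 t3]; have /andP[? ?] := reduce_itv t.
apply/esym/eqP; rewrite -subr_eq0; apply/eqP/periods_small; first exact: reduce_periods.
by apply/andP; split; lra.
Qed.

Lemma phi_pi (t : R) : phi (\pi_(trop_jacobian k) t) = phi_rep k (reduce k t).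
Proof.
rewrite /phi; congr phi_rep; apply: reduce_eq.
by apply/jacobian_eq; rewrite reprK.
Qed.

Lemma phi1 (t : R) : 0 <= t <= k -> phi (\pi_(trop_jacobian k) t) = (k - 2 * t, k - t).
Proof.
have k0' := k0.
move=> /andP[t0 tk]; rewrite phi_pi reduce_id; last by apply/andP; split; lra.
by rewrite /phi_rep tk.
Qed.

Lemma phi2 (t : R) : 0 <= t <= k -> phi (\pi_(trop_jacobian k) (k + t)) = (- k + t, - t).
Proof.
have k0' := k0.
move=> /andP[t0 tk]; rewrite phi_pi reduce_id; last by apply/andP; split; lra.
rewrite /phi_rep; case: leP => h1.
  by congr pair; lra.
by rewrite ifT; last lra; congr pair; lra.
Qed.

Lemma phi3 (t : R) : 0 <= t <= k ->
  phi (\pi_(trop_jacobian k) (2 * k + t)) = (t, - k + 2 * t).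
Proof.
have k0' := k0.
move=> /andP[t0 tk]; have [->|tk'] := eqVneq t k.
  have -> : \pi_(trop_jacobian k) (2 * k + k) = \pi_(trop_jacobian k) 0.
    by apply/jacobian_eq/periodsP; exists 1; rewrite mul1r; ring.
  by rewrite phi1 ?lexx ?ltW //; congr pair; ring.
have {}tk' : t < k by rewrite lt_neqAle tk'.
rewrite phi_pi reduce_id; last by apply/andP; split; lra.
rewrite /phi_rep ifF; last by apply/negbTE; rewrite -ltNge; lra.
case: leP => h1; last by congr pair; ring.
by congr pair; lra.
Qed.

Lemma phi_bij : set_bij [set: trop_jacobian k] (hesse_bar k) (@phi R k).
Proof.
have k0' := k0.
rewrite hesse_barE; split.
- move=> u _; rewrite /phi; have := reduce_itv (repr u).
  move: (reduce _ _) => t /andP[t0 t3]; rewrite /phi_rep.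
  case: leP => h1; first by exists 1 => //; apply/edge1E; split=> /=; lra.
  case: leP => h2; first by exists 2 => //; apply/edge2E; split=> /=; lra.
  by exists 3 => //; apply/edge3E; split=> /=; lra.
- move=> u v _ _; rewrite -[u]reprK -[v]reprK !phi_pi => e.
  apply/jacobian_eq.
  have {}e : reduce k (repr u) = reduce k (repr v).
    have := reduce_itv (repr u); have := reduce_itv (repr v); move: e.
    move: (reduce _ _) => s; move: (reduce _ _) => t e /andP[? ?] /andP[? ?].
    move: e; rewrite /phi_rep.
    case: (leP s k) => ?; case: (leP t k) => ?; case: (leP s (2 * k)) => ?;
    case: (leP t (2 * k)) => ?; case=> ? ?; lra.
  have -> : repr u - repr v = (repr u - reduce k (repr u)) - (repr v - reduce k (repr v)).
    by rewrite e; ring.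
  by rewrite rpredB // reduce_periods.
- move=> [X Y] [i _]; move: i; elim/Z3_ind => [/edge1E|/edge2E|/edge3E] /= [? ? ?].
  + exists (\pi_(trop_jacobian k) (k - Y)) => //; rewrite phi1; first by congr pair; lra.
    by apply/andP; split; lra.
  + exists (\pi_(trop_jacobian k) (k + (- Y))) => //; rewrite phi2; first by congr pair; lra.
    by apply/andP; split; lra.
  + exists (\pi_(trop_jacobian k) (2 * k + X)) => //; rewrite phi3; first by congr pair; lra.
    by apply/andP; split; lra.
Qed.

Lemma hesse_addE (u v : trop_jacobian k) :
  hesse_add k (phi u) (phi v) = phi (u + v).
Proof.
have k0' := k0.
have inj u' v' : phi u' = phi v' -> u' = v' :> trop_jacobian k.
  have [_ inj _] := phi_bij => e; by apply: inj => //; rewrite in_setT.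
have phiK w : phi_inv k (phi w) = w.
  apply: inj.
  exact: (@xgetPex _ 0 [set u' | phi u' = phi w] (ex_intro _ w erefl)).
by rewrite /hesse_add !phiK.
Qed.

End Facts.

(* Main.v *)
(* Translation by V_2 is the linear map [rot], of order 3, which permutes the
   vertices cyclically and maps E_i to E_(i+1).  Read projectively, it permutes
   the three max-expressions of each formula cyclically, up to a common summand,
   so each formula is invariant under (P, Q, P + Q) |-> (rot P, rot Q, rot^2 (P + Q))
   and one may assume P on E_1.  Then P, Q and P + Q are affine in the lattice
   distances s, t of P and Q from the start of their edges, on each side of
   s + t = k, and the claims become linear inequalities; the wrong formula can
   only hold when s or t is 0 or k. *)
Require Import Defs.
From mathcomp Require Import all_boot all_order all_algebra generic_quotient ring_quotient.
From mathcomp Require Import all_classical all_reals all_analysis.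
From mathcomp Require Import ring lra.

Set Implicit Arguments.
Unset Strict Implicit.
Unset Printing Implicit Defensive.

Import Order.TTheory GRing.Theory Num.Theory.

Local Open Scope classical_set_scope.
Local Open Scope ring_scope.
Local Open Scope quotient_scope.

Section Rotation.
Variables (R : realType) (k : R) (k0 : 0 < k).

Implicit Types (p q s : R * R) (i j : 'Z_3) (u v : trop_jacobian k).

(** * Rotation, edges and the group law *)

Definition rot p : R * R := (- p.2, p.1 - p.2).

(** The lattice-length parametrization of E_1 from V_1; applying [rot] once or twice gives those of
    E_2 and E_3. *)
Definition arc (t : R) : R * R := (k - 2 * t, k - t).

Lemma rot3 p : rot (rot (rot p)) = p.
Proof. by case: p => x y; rewrite /rot /=; congr pair; ring. Qed.

Lemma rot_vertex i : rot (vertex k i) = vertex k (i + 1).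
Proof.
elim/Z3_ind: i; rewrite Z3D !vertexE /rot /=; congr pair; ring.
Qed.

Lemma edge_arc p : edge k 1 p <-> exists2 t, 0 <= t <= k & p = arc t.
Proof.
rewrite (edge1E k0); split=> [[e y0 yk]|[t /andP[t0 tk] ->]].
  by exists (k - p.2); [lra | case: p e y0 yk => x y /= *; congr pair; lra].
by rewrite /arc /=; split; lra.
Qed.

Lemma edge_rot i p : edge k (i + 1) (rot p) <-> edge k i p.
Proof.
elim/Z3_ind: i; rewrite Z3D ?(edge1E k0) ?(edge2E k0) ?(edge3E k0) /rot /=.
all: by split=> -[? ? ?]; split; lra.
Qed.

Lemma piD (s t : R) :
  \pi_(trop_jacobian k) (s + t) = \pi_(trop_jacobian k) s + \pi_(trop_jacobian k) t.
Proof. exact: raddfD. Qed.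

Lemma pi_period : \pi_(trop_jacobian k) (3 * k) = 0.
Proof.
rewrite -(raddf0 (\pi_(trop_jacobian k))).
by apply/jacobian_eq/periodsP; exists 1; rewrite mul1r subr0.
Qed.

Lemma phi_arc (t : R) : 0 <= t <= k -> phi (\pi_(trop_jacobian k) t) = arc t.
Proof. exact: phi1. Qed.

(** The class of [k] is V_2, and adding it moves a point to the next edge at the same distance from
    the start of that edge. The cases are the three edges. *)
Lemma phi_rot u : phi (u + \pi k) = rot (phi u).
Proof.
have -> : u = \pi_(trop_jacobian k) (reduce k (repr u)).
  by rewrite -{1}[u]reprK; apply/jacobian_eq; exact: reduce_periods.
have /andP[t0 t3] := reduce_itv k0 (repr u).
move: (reduce _ _) t0 t3 => t t0 t3; rewrite -piD.
have [tk|kt] := leP t k.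
  by rewrite addrC (phi2 k0) ?(phi1 k0) /rot /= ?t0 //; congr pair; ring.
have [tk|kkt] := leP t (2 * k).
  have -> : t + k = 2 * k + (t - k) by ring.
  have {2}-> : t = k + (t - k) by ring.
  by rewrite (phi3 k0) ?(phi2 k0) /rot /=; [congr pair; ring | lra..].
(* From E_3 the translate passes V_1; dropping one period places it on E_1. *)
have -> : t + k = (t - 2 * k) + 3 * k by ring.
have {2}-> : t = 2 * k + (t - 2 * k) by ring.
rewrite piD pi_period addr0.
by rewrite (phi3 k0) ?(phi1 k0) /rot /=; [congr pair; ring | lra..].
Qed.

Lemma bar_phi p : hesse_bar k p -> exists u, p = phi u.
Proof. by have [_ _ surj] := phi_bij k0 => /surj[u _ <-]; exists u. Qed.

(** Since [rot] is addition of V_2, this is associativity and commutativity in the Jacobian. *)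
Lemma hesse_add_rotl p q : hesse_bar k p -> hesse_bar k q ->
  hesse_add k (rot p) q = rot (hesse_add k p q).
Proof.
move=> /bar_phi[u ->] /bar_phi[v ->].
by rewrite -phi_rot !hesse_addE // -phi_rot addrAC.
Qed.

Lemma hesse_addC p q : hesse_add k p q = hesse_add k q p.
Proof. by rewrite /hesse_add addrC. Qed.

Lemma hesse_add_rotr p q : hesse_bar k p -> hesse_bar k q ->
  hesse_add k p (rot q) = rot (hesse_add k p q).
Proof.
move=> bp bq; rewrite [LHS]hesse_addC hesse_add_rotl //.
by rewrite hesse_addC.
Qed.

Lemma bar_rot p : hesse_bar k (rot p) <-> hesse_bar k p.
Proof.
rewrite (hesse_barE k0); split=> -[i _ ip].
  by exists (i - 1) => //; apply/edge_rot; rewrite subrK.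
by exists (i + 1) => //; apply/edge_rot.
Qed.

Lemma hesse_add_rot p q : hesse_bar k p -> hesse_bar k q ->
  hesse_add k (rot p) (rot q) = rot (rot (hesse_add k p q)).
Proof.
by move=> bp bq; rewrite hesse_add_rotl ?bar_rot // hesse_add_rotr.
Qed.

Lemma bar_arc t : 0 <= t <= k -> hesse_bar k (arc t).
Proof. by move=> tk; rewrite (hesse_barE k0); exists 1 => //; apply/edge_arc; exists t. Qed.

(** Lattice lengths add; beyond [k] the sum has passed V_2 and lies on E_2, the rotated E_1. *)
Lemma hesse_add_arc (s t : R) : 0 <= s <= k -> 0 <= t <= k ->
  hesse_add k (arc s) (arc t) =
    if s + t <= k then arc (s + t) else rot (arc (s + t - k)).
Proof.
move=> sk tk; rewrite -(phi_arc sk) -(phi_arc tk) hesse_addE // -piD.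
case: leP => st; first by rewrite phi_arc //; lra.
rewrite -[s + t](subrK k) piD phi_rot phi_arc ?addrK //; lra.
Qed.

(** * The three formulae and their invariance *)

Definition formula1 p q s :=
  s.1 = Num.max p.2 (2 * p.1 + q.1 + q.2) - Num.max (p.1 + 2 * q.1) (2 * p.2 + q.2) /\
  s.2 = Num.max (p.1 + p.2 + 2 * q.2) q.1 - Num.max (p.1 + 2 * q.1) (2 * p.2 + q.2).

Definition formula2 p q s :=
  s.1 = Num.max (p.1 + p.2 + 2 * q.1) q.2 - Num.max (p.2 + 2 * q.2) (2 * p.1 + q.1) /\
  s.2 = Num.max p.1 (2 * p.2 + q.1 + q.2) - Num.max (p.2 + 2 * q.2) (2 * p.1 + q.1).

Definition formula3 p q s :=
  s.1 = Num.max (p.1 + 2 * q.2) (2 * p.2 + q.1) - Num.max (p.1 + p.2) (q.1 + q.2) /\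
  s.2 = Num.max (p.2 + 2 * q.1) (2 * p.1 + q.2) - Num.max (p.1 + p.2) (q.1 + q.2).

(** A maximum is split into cases only if [lra] cannot decide which argument is larger. *)
Ltac tropical :=
  repeat match goal with |- context [Num.max ?a ?b] =>
    first [rewrite (@max_l _ _ a b); last lra|rewrite (@max_r _ _ a b); last lra
          | case: (leP a b) => ?]
  end; lra.

(* In homogeneous coordinates (a : b : c), with the dehomogenization (a - c, b - c). *)
Lemma rot_proportional (a b c a' b' c' d : R) s :
    a' = b + d -> b' = c + d -> c' = a + d ->
  ((rot (rot s)).1 = a' - c' /\ (rot (rot s)).2 = b' - c') <->
  (s.1 = a - c /\ s.2 = b - c).
Proof. by rewrite /rot /= => -> -> ->; split; lra. Qed.

Lemma formula1_rot p q s :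
  formula1 (rot p) (rot q) (rot (rot s)) <-> formula1 p q s.
Proof.
(* The shift comes from comparing terms: each argument of a rotated maximum is the matching argument
   of the next maximum minus [2 * (p.2 + q.2)]. *)
apply: (@rot_proportional _ _ _ _ _ _ (- 2 * (p.2 + q.2))); rewrite addr_maxl /=.
all: by congr Num.max; ring.
Qed.

Lemma formula2_rot p q s :
  formula2 (rot p) (rot q) (rot (rot s)) <-> formula2 p q s.
Proof.
apply: (@rot_proportional _ _ _ _ _ _ (- 2 * (p.2 + q.2))); rewrite addr_maxl /=.
all: by congr Num.max; ring.
Qed.

Lemma formula3_rot p q s :
  formula3 (rot p) (rot q) (rot (rot s)) <-> formula3 p q s.
Proof.
apply: (@rot_proportional _ _ _ _ _ _ (- 2 * (p.2 + q.2))); rewrite addr_maxl /=.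
all: by congr Num.max; ring.
Qed.

(** * P on E_1 and Q on each edge in turn *)

(** The third formula exceeds the true first coordinate by 3 min(s, t) if s + t <= k, and by 3 (k -
    max(s, t)) otherwise. For 0 < s < k this defect vanishes only at t = 0 or t = k. *)
Lemma formulae_edge1 (s t : R) : 0 <= s <= k -> 0 <= t <= k ->
  let p := arc s in let q := arc t in let r := hesse_add k p q in
  [/\ formula1 p q r, formula2 p q r &
      0 < s < k -> formula3 p q r -> t = 0 \/ t = k].
Proof.
move=> sk tk /=; rewrite hesse_add_arc // /formula1 /formula2 /formula3.
move: sk tk => /andP[s0 sk] /andP[t0 tk].
case: (leP (s + t) k) => st; rewrite /arc /rot /=; split.
1,2,4,5: tropical.
all: move: t0; rewrite le_eqVlt => /predU1P[<-|t0]; first by left.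
all: move: tk; rewrite le_eqVlt => /predU1P[->|tk]; first by right.
all: by move=> /andP[s0' sk'] [fx fy]; exfalso; move: fx fy; tropical.
Qed.

(** The second formula has the same defect, now in the second coordinate. *)
Lemma formulae_edge2 (s t : R) : 0 <= s <= k -> 0 <= t <= k ->
  let p := arc s in let q := rot (arc t) in let r := hesse_add k p q in
  [/\ formula1 p q r, formula3 p q r &
      0 < s < k -> formula2 p q r -> t = 0 \/ t = k].
Proof.
move=> sk tk /=; have bs := bar_arc sk; have bt := bar_arc tk.
rewrite hesse_add_rotr // hesse_add_arc //.
move: sk tk => /andP[s0 sk] /andP[t0 tk].
rewrite /formula1 /formula2 /formula3.
case: (leP (s + t) k) => st; rewrite /arc /rot /=; split.
1,2,4,5: tropical.
all: move: t0; rewrite le_eqVlt => /predU1P[<-|t0]; first by left.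
all: move: tk; rewrite le_eqVlt => /predU1P[->|tk]; first by right.
all: by move=> /andP[s0' sk'] [fx fy]; exfalso; move: fx fy; tropical.
Qed.

(** The first formula falls short by the same defect in both coordinates. *)
Lemma formulae_edge3 (s t : R) : 0 <= s <= k -> 0 <= t <= k ->
  let p := arc s in let q := rot (rot (arc t)) in let r := hesse_add k p q in
  [/\ formula2 p q r, formula3 p q r &
      0 < s < k -> formula1 p q r -> t = 0 \/ t = k].
Proof.
move=> sk tk /=; have bs := bar_arc sk; have bt := bar_arc tk.
rewrite !hesse_add_rotr ?bar_rot // hesse_add_arc //.
move: sk tk => /andP[s0 sk] /andP[t0 tk].
rewrite /formula1 /formula2 /formula3.
case: (leP (s + t) k) => st; rewrite /arc /rot /=; split.
1,2,4,5: tropical.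
all: move: t0; rewrite le_eqVlt => /predU1P[<-|t0]; first by left.
all: move: tk; rewrite le_eqVlt => /predU1P[->|tk]; first by right.
all: by move=> /andP[s0' sk'] [fx fy]; exfalso; move: fx fy; tropical.
Qed.

(** * From edge 1 to all edges *)

(** The converses exclude vertices: there s is 0 or k, the defect vanishes for every Q, and all
    three formulae hold on the whole bounded curve. *)
Definition addition_formulae (j : 'Z_3) p q : Prop :=
  let r := hesse_add k p q in
  [/\ (edge k j `|` edge k (j + 1)) q -> formula1 p q r,
      (edge k j `|` edge k (j + 2)) q -> formula2 p q r &
      (edge k (j + 1) `|` edge k (j + 2)) q -> formula3 p q r] /\
  ((forall i, p <> vertex k i) ->
   [/\ formula1 p q r <-> (edge k j `|` edge k (j + 1)) q,
       formula2 p q r <-> (edge k j `|` edge k (j + 2)) q &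
       formula3 p q r <-> (edge k (j + 1) `|` edge k (j + 2)) q]).

Lemma arc_vertex : (arc 0 = vertex k 1) * (arc k = vertex k 2).
Proof. by split; rewrite /arc vertexE; congr pair; ring. Qed.

Lemma edge_vertex i : edge k i (vertex k i) /\ edge k i (vertex k (i + 1)).
Proof.
have k0' := k0.
by elim/Z3_ind: i; rewrite Z3D !vertexE; split;
  rewrite ?(edge1E k0) ?(edge2E k0) ?(edge3E k0) /=; split; lra.
Qed.

Lemma addition_formulae_edge1 p q :
  edge k 1 p -> hesse_bar k q -> addition_formulae 1 p q.
Proof.
move=> /edge_arc[s sk ->] bq; rewrite /addition_formulae.
have -> : 1 + 2 = 3 :> 'Z_3 by exact/val_inj.
rewrite Z3D.
have s_open : (forall i, arc s <> vertex k i) -> 0 < s < k.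
  move=> sV; case/andP: sk => s0 sk; rewrite !lt_neqAle s0 sk !andbT.
  apply/andP; split; apply/eqP => E; [apply: (sV 1)|apply: (sV 2)].
    by rewrite -E arc_vertex.
  by rewrite E arc_vertex.
have E2 q' : edge k 2 q' -> exists2 t, 0 <= t <= k & q' = rot (arc t).
  (* Writing [q'] as a triple rotation lets one [rot] be peeled off, leaving a point of E_1. *)
  rewrite -{1}[q']rot3 -[2](Z3D.1.1) => /edge_rot/edge_arc[t tk e].
  by exists t => //; rewrite -e rot3.
have E3 q' : edge k 3 q' -> exists2 t, 0 <= t <= k & q' = rot (rot (arc t)).
  rewrite -{1}[q']rot3 -[3](Z3D.1.2) => /edge_rot/E2[t tk e].
  by exists t => //; rewrite -e rot3.
have F1 : (edge k 1 `|` edge k 2) q -> formula1 (arc s) q (hesse_add k (arc s) q).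
  by case=> [/edge_arc|/E2][t tk ->]; [case: (formulae_edge1 sk tk)|case: (formulae_edge2 sk tk)].
have F2 : (edge k 1 `|` edge k 3) q -> formula2 (arc s) q (hesse_add k (arc s) q).
  by case=> [/edge_arc|/E3][t tk ->]; [case: (formulae_edge1 sk tk)|case: (formulae_edge3 sk tk)].
have F3 : (edge k 2 `|` edge k 3) q -> formula3 (arc s) q (hesse_add k (arc s) q).
  by case=> [/E2|/E3][t tk ->]; [case: (formulae_edge2 sk tk)|case: (formulae_edge3 sk tk)].
split=> // /s_open s_in.
have [V1 V2] := edge_vertex 1; have [V2' V3] := edge_vertex 2.
have [V3' V1'] := edge_vertex 3; rewrite Z3D in V2 V3 V1'.
(* Only the forward implications remain. The formula whose domain omits the edge of Q forces Q to be
   an end of it, hence a point of an adjacent edge. *)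
move: bq; rewrite (hesse_barE k0) => -[i _]; elim/Z3_ind: i => qi; split; split=> //.
- by move=> _; left.
- by move=> _; left.
- have [t tk qt] := (edge_arc _).1 qi; have [_ _ N] := formulae_edge1 sk tk.
  by rewrite qt => /(N s_in)[]->; rewrite arc_vertex; [right|left].
- by move=> _; right.
- have [t tk qt] := E2 _ qi; have [_ _ N] := formulae_edge2 sk tk.
  by rewrite qt => /(N s_in)[]->; rewrite arc_vertex rot_vertex Z3D; [left|right].
- by move=> _; left.
- have [t tk qt] := E3 _ qi; have [_ _ N] := formulae_edge3 sk tk.
  by rewrite qt => /(N s_in)[]->; rewrite arc_vertex !rot_vertex !Z3D; [right|left].
- by move=> _; right.
- by move=> _; right.
Qed.

(** Rotating P and Q rotates the sum twice, which is the invariance of the formulae, while edges and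
    vertices shift by one index. *)
Lemma addition_formulae_rot (j : 'Z_3) p q : hesse_bar k p -> hesse_bar k q ->
  addition_formulae j p q -> addition_formulae (j + 1) (rot p) (rot q).
Proof.
move=> bp bq; rewrite /addition_formulae hesse_add_rot //.
have edgeU_rot i i' : (edge k (i + 1) `|` edge k (i' + 1)) (rot q) <->
    (edge k i `|` edge k i') q.
  by rewrite /setU /= !edge_rot.
rewrite [j + 1 + 2]addrAC !(propext (formula1_rot _ _ _)) !(propext (formula2_rot _ _ _)).
rewrite !(propext (formula3_rot _ _ _)) !(propext (edgeU_rot _ _)).
move=> [F N]; split=> // pV; apply: N => i pi; apply: (pV (i + 1)).
by rewrite pi rot_vertex.
Qed.

Lemma addition_formulaeP (j : 'Z_3) p q :
  edge k j p -> hesse_bar k q -> addition_formulae j p q.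
Proof.
(* As [rot] has order 3, every point is a rotated one, so the claim passes to the next edge. *)
have step i : (forall p q, edge k i p -> hesse_bar k q -> addition_formulae i p q) ->
    forall p q, edge k (i + 1) p -> hesse_bar k q -> addition_formulae (i + 1) p q.
  move=> IH p' q'; rewrite -[p']rot3 -[q']rot3 => /edge_rot ep /bar_rot bq.
  apply: addition_formulae_rot => //; last exact: IH.
  by rewrite (hesse_barE k0); exists i.
have A1 := addition_formulae_edge1.
have A2 := step _ A1; have A3 := step _ A2; rewrite !Z3D in A2 A3.
by elim/Z3_ind: j p q.
Qed.

End Rotation.

Theorem corollary1 (R : realType) (kappa : R) (kappa_gt0 : 0 < kappa)
    (j : 'Z_3) (X Y X' Y' X'' Y'' : R)
    (PE : edge kappa j (X, Y)) (QC : hesse_bar kappa (X', Y'))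
    (PQ : hesse_add kappa (X, Y) (X', Y') = (X'', Y'')) :
  let formula1 :=
    X'' = Num.max Y (2 * X + X' + Y') - Num.max (X + 2 * X') (2 * Y + Y') /\
    Y'' = Num.max (X + Y + 2 * Y') X' - Num.max (X + 2 * X') (2 * Y + Y') in
  let formula2 :=
    X'' = Num.max (X + Y + 2 * X') Y' - Num.max (Y + 2 * Y') (2 * X + X') /\
    Y'' = Num.max X (2 * Y + X' + Y') - Num.max (Y + 2 * Y') (2 * X + X') in
  let formula3 :=
    X'' = Num.max (X + 2 * Y') (2 * Y + X') - Num.max (X + Y) (X' + Y') /\
    Y'' = Num.max (Y + 2 * X') (2 * X + Y') - Num.max (X + Y) (X' + Y') in
  [/\ (edge kappa j `|` edge kappa (j + 1)) (X', Y') -> formula1,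
      (edge kappa j `|` edge kappa (j + 2)) (X', Y') -> formula2 &
      (edge kappa (j + 1) `|` edge kappa (j + 2)) (X', Y') -> formula3] /\
  ((forall i : 'Z_3, (X, Y) <> vertex kappa i) ->
   [/\ formula1 <-> (edge kappa j `|` edge kappa (j + 1)) (X', Y'),
       formula2 <-> (edge kappa j `|` edge kappa (j + 2)) (X', Y') &
       formula3 <-> (edge kappa (j + 1) `|` edge kappa (j + 2)) (X', Y')]).
Proof.
by move: (addition_formulaeP kappa_gt0 PE QC); rewrite /addition_formulae PQ.
Qed.
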